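(* Let $p$ be a prime and let $G$ be a special $p$-group of order $p^n$ and rank $k$, where $2 \leq k \leq \binom{d}{2}$ and $d = d(G)$ is the minimal number of generators of $G$. Let $r$ be the positive integer such that $\binom{r}{2} \leq \binom{d}{2} - k < \binom{r+1}{2}$, and set $s := \binom{d}{2} - k - \binom{r}{2}$. Then $$|\mathcal{M}(G)| \leq p^{\frac{d(d+2k-1)}{2} - k - \binom{d}{3} + \binom{r}{3} + \binom{s}{2}}.$$
   Context: A finite $p$-group $G$ is called a special $p$-group of rank $k$ if $\gamma_2 G = Z(G) = \Phi(G)$ and this subgroup is elementary abelian of order $p^k$; here $\gamma_2 G$ is the commutator subgroup, $Z(G)$ the center and $\Phi(G)$ the Frattini subgroup of $G$. $\mathcal{M}(G)$ denotes the Schur multiplier of $G$, i.e. the second integral homology group $H_2(G,\mathbb{Z})$ with $G$ acting trivially on $\mathbb{Z}$. Binomial coefficients $\binom{a}{b}$ with $0 \le a < b$ are $0$. *)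

(* Defs.v *)
(* MathComp, with mathcomp-classical for decidability of the relation "being
   homologous" and for cardinalities. *)
From HB Require Import structures.
From mathcomp Require Import all_boot all_order all_algebra.
From mathcomp Require Import all_fingroup all_solvable.
From mathcomp Require Import boolp classical_sets cardinality.

Set Implicit Arguments.
Unset Strict Implicit.
Unset Printing Implicit Defensive.

Import GRing.Theory.

Local Open Scope ring_scope.

(* {ffun I -> int} is the free abelian group on the finite type I. *)
Definition gen_of (I : finType) (i : I) : {ffun I -> int} :=
  [ffun j => (j == i)%:R].

Definition free_ext (I : finType) (V : zmodType) (f : I -> V)
  (c : {ffun I -> int}) : V := \sum_(i : I) f i *~ c i.

Lemma free_extB (I : finType) (V : zmodType) (f : I -> V) :
  {morph free_ext f : c c' / c - c'}.
Proof.
move=> c c'; rewrite /free_ext -sumrB; apply: eq_bigr => i _.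
by rewrite !ffunE mulrzBr.
Qed.

Section SchurMultiplier.

Variable T : finGroupType.

(* The bar complex of T with trivial coefficients Z in degrees 1, 2, 3: chains
   of degree n form the free abelian group on n-tuples of elements of T. *)
Definition chain1 := {ffun T -> int}.
Definition chain2 := {ffun T * T -> int}.
Definition chain3 := {ffun T * T * T -> int}.

(* [g|h] |-> [h] - [gh] + [g] *)
Definition bar_d2 : chain2 -> chain1 :=
  free_ext (fun '(g, h) => gen_of h - gen_of (g * h)%g + gen_of g).

(* [g|h|k] |-> [h|k] - [gh|k] + [g|hk] - [g|h] *)
Definition bar_d3 : chain3 -> chain2 :=
  free_ext (fun '(g, h, k) =>
    gen_of (h, k) - gen_of ((g * h)%g, k) + gen_of (g, (h * k)%g)
    - gen_of (g, h)).

Definition cycle2 : {pred chain2} := [pred c | bar_d2 c == 0].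

Fact cycle2_zmod_closed : zmod_closed cycle2.
Proof.
split=> [|c c']; rewrite !inE.
  by rewrite -(subrr (0 : chain2)) /bar_d2 free_extB subrr.
by move=> /eqP c0 /eqP c'0; rewrite /bar_d2 free_extB -/bar_d2 c0 c'0 subrr.
Qed.

HB.instance Definition _ :=
  GRing.isZmodClosed.Build chain2 cycle2 cycle2_zmod_closed.

Record Z2 := MkZ2 { Z2_val :> chain2; _ : Z2_val \in cycle2 }.

HB.instance Definition _ := [isSub for Z2_val].
HB.instance Definition _ := [Choice of Z2 by <:].
HB.instance Definition _ := [SubChoice_isSubZmodule of Z2 by <:].

Definition B2 : {pred Z2} :=
  [pred z : Z2 | `[< exists c : chain3, bar_d3 c = Z2_val z >]].

Fact B2_zmod_closed : zmod_closed B2.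
Proof.
split=> [|z z' /asboolP[c cz] /asboolP[c' cz']]; apply/asboolP.
  exists (0 - 0).
  by rewrite /bar_d3 free_extB subrr -[RHS]/(val (0 : Z2)) raddf0.
exists (c - c').
by rewrite /bar_d3 free_extB -/bar_d3 cz cz' -[RHS]/(val (z - z')) raddfB.
Qed.

HB.instance Definition _ := GRing.isZmodClosed.Build Z2 B2 B2_zmod_closed.

(* The Schur multiplier H_2(T, Z), as the quotient abelian group Z2 / B2. *)
Definition schur_multiplier : zmodType := Quotient.quot B2.

End SchurMultiplier.

(* The Schur multiplier of a subgroup G of an ambient group is that of the
   type [subg G] of its elements. *)
Definition schur (gT : finGroupType) (G : {group gT}) : zmodType :=
  schur_multiplier (subg_of G).

(* [special G] says that 'Phi(G) = 'Z(G) and G^`(1) = 'Z(G). *)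
Definition special_of_rank (gT : finGroupType) (p k : nat) (G : {group gT}) :=
  [/\ p.-group G, special G, p.-abelem 'Z(G) & #|'Z(G)| = (p ^ k)%N]%g.

(* Main.v *)
Require Import Defs.
From HB Require Import structures.
From mathcomp Require Import all_boot all_order all_algebra.
From mathcomp Require Import all_fingroup all_solvable.
From mathcomp Require Import zify ring.
From mathcomp Require Import boolp.

(** The bound is the Ganea exact sequence V (x) W -> M(G) -> M(V) -> W -> 0,
    with V = G/Z(G) and W = Z(G) = G', together with a lower bound for the
    kernel of its first map, which contains the Jacobi elements
    u (x) [v,w] + v (x) [w,u] + w (x) [u,v].

    Everything is read off one finite central extension E of G by A.  Reducing
    2-chains modulo |G| and killing boundaries gives a finite group A carrying
    the universal 2-cocycle, and E is the extension it defines.  Cycles embed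
    modulo boundaries into A, because |G| annihilates H_2 ([card_mul_cycle],
    [chain_class_cycle]), and their classes are commutators
    ([cycle_in_der1]): this is Hopf's formula, and it is enough to bound the
    order of E' n A.

    For any central extension E of a special group E/A of rank k with d
    generators x_1, ..., x_d, the order of E' n A is computed along
    E' >= [E', E].  The quotient E'/[E', E] is elementary abelian and generated
    by the binomial (d, 2) commutators [x_i, x_j].  The group [E', E] is
    elementary abelian, generated by the elements [[x_i, x_j], x_l]; here
    {i, j} may be taken in a set B of k pairs whose commutators form a basis of
    E'/A, which leaves dk generators.  Choosing B greedily for the weight
    2^i + 2^j makes the Hall-Witt identity eliminate one more generator for
    each triple {i, j, l} containing a pair of B: the other two terms of the
    identity are either kept or expressible by generators of smaller total
    weight ([lie_gen_mem]).

    The triples that give no saving are the triangles of the graph of pairs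
    outside B, which has binomial (d, 2) - k = binomial (r, 2) + s edges.  Such
    a graph has at most binomial (r, 3) + binomial (s, 2) triangles
    ([triangles_le], the Kruskal-Katona theorem for graphs), whence the bound.
*)

Set Implicit Arguments.
Unset Strict Implicit.
Unset Printing Implicit Defensive.

Import GRing.Theory Num.Theory.

(** * Graphs with many triangles *)

Section Triangles.
Variable I : finType.
Implicit Types (F : {set {set I}}) (v : I).

Definition triangles F :=
  [set T : {set I} | (#|T| == 3) && [forall v in T, T :\ v \in F]].

Definition degree F v := #|[set P in F | v \in P]|.

Lemma bin2D a b : 'C(a + b, 2) = 'C(a, 2) + 'C(b, 2) + a * b.
Proof.
elim: a => [|a IH]; first by rewrite add0n addn0.
by rewrite addSn !binS IH !bin1; lia.
Qed.

Lemma degree_neighbours F v : {in F, forall P : {set I}, #|P| = 2} ->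
  degree F v = #|[set u | (u != v) && ([set u; v] \in F)]|.
Proof.
move=> F2; rewrite /degree; set N := [set u | (u != v) && _].
have inj : {in N &, injective (fun u => [set u; v])}.
  move=> u u'; rewrite !inE => /andP[uv _] _ /setP/(_ u).
  by rewrite !inE eqxx (negPf uv) !orbF => /esym/eqP.
rewrite -(card_in_imset inj); apply: eq_card => P; rewrite !inE.
apply/andP/imsetP => [[PF vP]|[u]]; last first.
  by rewrite !inE => /andP[_ PF] ->; rewrite PF !inE eqxx orbT.
have /eqP/cards1P[u Du] : #|P :\ v| = 1.
  by have := cardsD1 v P; rewrite vP F2 // => -[].
have DP : P = [set u; v] by rewrite -(setD1K vP) Du setUC.
exists u => //; rewrite inE -DP PF andbT.
have : u \in P :\ v by rewrite Du inE.
by rewrite !inE => /andP[].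
Qed.

Lemma sum_degree F : {in F, forall P : {set I}, #|P| = 2} ->
  \sum_(v in cover F) degree F v = (#|F|).*2.
Proof.
move=> F2.
under eq_bigr => v _ do rewrite /degree -sum1_card big_mkcond /=.
rewrite exchange_big /= (bigID (mem F)) /= [X in _ + X]big1 ?addn0; last first.
  by move=> P PF; rewrite big1 // => v _; rewrite inE (negPf PF).
rewrite -muln2 -sum_nat_const; apply: eq_bigr => P PF.
rewrite -(F2 P PF) -sum1_card [LHS]big_mkcond [RHS]big_mkcond; apply: eq_bigr => v _.
rewrite inE PF /=; case: ifP; case: ifP => //= vP; rewrite ?vP //.
by move/bigcupP=> []; exists P.
Qed.

(** A triangle through [v] is determined by its opposite edge, which joins two
    neighbours of [v]. *)
Lemma triangles_vertex F v : {in F, forall P : {set I}, #|P| = 2} ->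
  #|triangles F| <= #|triangles [set P in F | v \notin P]| + 'C(degree F v, 2).
Proof.
move=> F2; rewrite -(cardsID [set T : {set I} | v \notin T]) leq_add //.
  apply/subset_leq_card/subsetP => T; rewrite !inE => /andP[/andP[-> /forallP h] vT].
  apply/forallP=> u; apply/implyP => uT; rewrite inE (implyP (h u)) //=.
  by rewrite !inE negb_and vT orbT.
rewrite (degree_neighbours v F2); set N := [set u | (u != v) && _].
rewrite -cards_draws.
have inj : {in triangles F :\: [set T : {set I} | v \notin T] &,
    injective (fun T : {set I} => T :\ v)}.
  move=> T T'; rewrite !inE !negbK => /andP[vT _] /andP[vT' _] e.
  by rewrite -(setD1K vT) e setD1K.
rewrite -(card_in_imset inj); apply/subset_leq_card/subsetP => _ /imsetP[T + ->].
rewrite !inE negbK => /andP[vT /andP[/eqP T3 /forallP h]].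
have T2 : #|T :\ v| = 2 by move: T3; rewrite (cardsD1 v T) vT => -[].
rewrite T2 eqxx andbT; apply/subsetP => u uT.
rewrite inE; move: (uT); rewrite !inE => /andP[uv uT']; rewrite uv /=.
have /cards1P[w Dw] : #|(T :\ v) :\ u| == 1.
  by move: T2; rewrite (cardsD1 u) uT add1n => -[->].
have : w \in T :\ v :\ u by rewrite Dw inE.
rewrite !inE => /and3P[wu wv wT].
suff <- : T :\ w = [set u; v] by rewrite (implyP (h w)).
rewrite -(setD1K vT) -(setD1K uT) Dw; apply/setP=> z; rewrite !inE.
by case: (eqVneq z w) => [->|]; rewrite ?(negPf wv) ?(negPf wu) //= orbF orbC.
Qed.

(** Removing a vertex [v] of minimal degree [e] loses at most binomial (e, 2)
    triangles.  Such a vertex has [e < r]: at least [e + 1] vertices have degree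
    at least [e], so [e (e + 1)] is at most twice the number of edges, which is
    less than [r (r + 1)].  The bound then follows by induction and convexity
    of the binomial (-, 2); the parameter [r] drops by one when [s < e]. *)
Lemma triangles_le F r s : {in F, forall P : {set I}, #|P| = 2} ->
  s < r -> #|F| = 'C(r, 2) + s -> #|triangles F| <= 'C(r, 3) + 'C(s, 2).
Proof.
have [m] := ubnP #|F|; elim: m F r s => // m IH F r s Fm F2 sr DF.
have [F0|[P PF]] := set_0Vmem F.
  rewrite (_ : triangles F = set0) ?cards0 //; apply/setP=> T.
  rewrite !inE; apply/negP => /andP[/eqP T3 /forallP h].
  have [v vT] : exists v, v \in T by apply/set0Pn; rewrite -cards_eq0 T3.
  by have := h v; rewrite vT F0 inE.
have [u uF] : exists u, u \in cover F.
  have [u uP] : exists u, u \in P by apply/set0Pn; rewrite -cards_eq0 F2.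
  by exists u; apply/bigcupP; exists P.
case: (arg_minnP (degree F) uF) => v vF' min_v; have {vF'} vF : v \in cover F by [].
set e := degree F v in min_v.
have e_gt0 : 0 < e.
  have /bigcupP[Q QF vQ] := vF.
  by apply/card_gt0P; exists Q; rewrite inE QF.
have cover_ge : e.+1 <= #|cover F|.
  rewrite /e degree_neighbours // (cardsD1 v (cover F)) vF ltnS.
  apply/subset_leq_card/subsetP => w; rewrite !inE => /andP[-> wF] /=.
  by apply/bigcupP; exists [set w; v]; rewrite ?inE ?eqxx.
have e_lt : e < r.
  have : \sum_(w in cover F) e <= \sum_(w in cover F) degree F w by exact: leq_sum.
  rewrite sum_degree // sum_nat_const DF.
  by have := mul_bin_diag r 1; rewrite bin1; nia.
have F'2 : {in [set P in F | v \notin P], forall P : {set I}, #|P| = 2}.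
  by move=> Q; rewrite inE => /andP[/F2].
have DF' : #|[set P in F | v \notin P]| + e = #|F|.
  rewrite addnC -[RHS](cardsID [set P : {set I} | v \in P]) /e /degree.
  by congr (_ + _); apply: eq_card => Q; rewrite !inE // andbC.
apply: leq_trans (triangles_vertex v F2) _; rewrite -/e.
have [es|se] := leqP e s.
  have := bin2D (s - e) e; rewrite subnK // => Ds.
  have := IH _ r (s - e) _ F'2; rewrite DF in DF'.
  have h1 : s - e < r by lia.
  have h2 : #|[set P0 in F | v \notin P0]| = 'C(r, 2) + (s - e) by lia.
  have h3 : #|[set P0 in F | v \notin P0]| < m by lia.
  by move=> /(_ h3 h1 h2); rewrite Ds; move: ((s - e) * e) => q; lia.
(* With e > s, the remaining edges number 'C(r.-1, 2) + (r.-1 + s - e). *)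
case: r sr e_lt DF => // r sr e_lt DF.
have h1 : r + s - e < r by lia.
have h2 : #|[set P0 in F | v \notin P0]| = 'C(r, 2) + (r + s - e).
  by move: DF; rewrite binS bin1; lia.
have h3 : #|[set P0 in F | v \notin P0]| < m by lia.
have := IH _ r _ h3 F'2 h1 h2.
have := bin2D (e - s) s; rewrite subnK; last lia.
have := bin2D (e - s) (r + s - e); rewrite (_ : e - s + (r + s - e) = r); last lia.
have : (e - s) * s <= (e - s) * (r + s - e) by rewrite leq_mul2l; lia.
rewrite binS; lia.
Qed.
End Triangles.

(** * Finite groups: generators, central commutators, greedy bases *)

Section GroupFacts.
Local Open Scope group_scope.
Variable gT : finGroupType.
Implicit Types (S : {set gT}) (E R : {group gT}).

Lemma abelem_gen p S : prime p -> abelian <<S>> ->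
  (forall x, x \in S -> x ^+ p = 1) -> p.-abelem <<S>>.
Proof.
move=> p_pr abS expS; rewrite abelemE // abS /=; apply/exponentP => x.
suff sSL : <<S>> \subset Group (group_Ldiv p abS).
  by move/(subsetP sSL); rewrite !inE => /andP[_ /eqP].
by rewrite gen_subG; apply/subsetP=> y yS; rewrite !inE mem_gen //= expS.
Qed.

Lemma card_abelem_gen p S : prime p -> p.-abelem <<S>> -> #|<<S>>| <= p ^ #|S|.
Proof.
move=> p_pr abS; have [n e] := p_natP (abelem_pgroup abS); rewrite e.
rewrite leq_exp2l ?prime_gt1 //; have := grank_min S.
by rewrite grank_abelian ?(abelem_abelian abS) // (rank_abelem abS) e pfactorK.
Qed.

(** It suffices to make generators commute modulo a normal subgroup. *)
Lemma der1_sub_gen S E R : <<S>> = E -> E \subset 'N(R) ->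
  (forall x y, x \in S -> y \in S -> [~ x, y] \in R) -> E^`(1) \subset R.
Proof.
move=> genE nRE cRS; apply: der1_min => //.
have nRS : S \subset 'N(R) by apply: subset_trans nRE; rewrite -genE subset_gen.
rewrite -genE quotient_gen // abelian_gen /abelian quotient_cents2 //.
by rewrite gen_subG; apply/subsetP=> _ /imset2P[x y xS yS ->]; apply: cRS.
Qed.

(** The preimage of the centraliser of the coset of [z]; as an explicit subgroup of
    [E] it lets membership in [R] of commutators [[~ h, z]] propagate from
    generators. *)
Definition cent_mod E R z := [set h in E | [~ h, z] \in R].

Lemma cent_mod_group_set E R z : E \subset 'N(R) -> group_set (cent_mod E R z).
Proof.
move=> nRE; apply/group_setP; split; first by rewrite !inE group1 comm1g group1.
move=> a b; rewrite !inE => /andP[aE aR] /andP[bE bR].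
by rewrite groupM // commMgJ groupM // memJ_norm // (subsetP nRE).
Qed.

(** Since [[E, E], E] is central, replacing an argument of an inner commutator by
    its inverse only inverts the triple commutator ([flip]), so the Hall-Witt
    identity becomes the Jacobi identity modulo [R]. *)
Lemma Hall_Witt_mod E R x y z : [~: [~: E, E], E] \subset 'Z(E) ->
   R \subset 'Z(E) -> x \in E -> y \in E -> z \in E ->
  [~ x, y, z] \in R -> [~ y, z, x] \in R -> [~ z, x, y] \in R.
Proof.
move=> cE cR xE yE zE.
have nRE : E \subset 'N(R).
  by rewrite (subset_trans _ (cent_sub _)) // centsC (subset_trans cR) ?subsetIr.
have flip a b c : a \in E -> b \in E -> c \in E ->
    ([~ a, b^-1, c] \in R) = ([~ a, b, c] \in R).
  move=> aE bE cE'; have abE : [~ a, b] \in [~: E, E] by rewrite mem_commg.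
  have sEE : [~: E, E] \subset E by rewrite commg_subl normG.
  have gC := cent_mod_group_set c nRE.
  have key h g : h \in [~: E, E] -> g \in E -> h \in Group gC -> h ^ g \in Group gC.
    move=> hE gE hC; rewrite conjg_mulR groupM // inE.
    have zZ : [~ h, g] \in 'Z(E) by rewrite (subsetP cE) // mem_commg.
    rewrite (subsetP (subsetIl _ _) _ zZ) /=.
    by have /centerP[_ /(_ c cE')/commgP/eqP ->] := zZ; rewrite group1.
  have invE : [~ a, b^-1] = ([~ a, b]^-1) ^ b^-1.
    by rewrite invg_comm /commg /conjg !invgK !mulgA mulgV mul1g.
  have inE' h : h \in E -> (h \in Group gC) = ([~ h, c] \in R).
    by move=> hE; rewrite !inE hE.
  rewrite -!inE' ?(subsetP sEE) ?mem_commg ?groupV // invE.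
  apply/idP/idP => [|abC]; last by rewrite key ?groupV.
  move/(key _ b); rewrite conjgKV groupV; apply=> //.
  by rewrite -invE mem_commg ?groupV.
rewrite -(flip x) // -(flip y) // -(flip z) // => h1 h2.
have := Hall_Witt_identity x y z.
move/(canRL (mulKg _)); rewrite mulg1 => e.
rewrite -(memJ_norm _ (subsetP nRE x xE)) e groupV groupM //.
  by rewrite memJ_norm // (subsetP nRE).
by rewrite memJ_norm // (subsetP nRE).
Qed.
End GroupFacts.

Section Greedy.
Local Open Scope group_scope.
Variables (gT : finGroupType) (W : {group gT}) (p : nat) (I : finType).
Variables (D : {set I}) (w : I -> gT) (wt : I -> nat).
Hypotheses (p_pr : prime p) (abW : p.-abelem W) (genW : <<w @: D>> = W).
Hypothesis wt_inj : {in D &, injective wt}.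

Definition below t := <<w @: [set P in D | wt P < t]>>.

(** The basis that Gaussian elimination in order of increasing weight selects. *)
Definition greedy := [set P in D | w P \notin below (wt P)].

Lemma below_abelem t : p.-abelem (below t).
Proof.
apply: abelemS abW; rewrite -genW genS // imsetS //.
by apply/subsetP=> P; rewrite inE => /andP[].
Qed.

Lemma gen_greedy : <<w @: greedy>> = W.
Proof.
apply/eqP; rewrite eqEsubset -{1}genW genS /=; last first.
  by apply/imsetS/subsetP => P; rewrite inE => /andP[].
rewrite -genW gen_subG; apply/subsetP=> _ /imsetP[P PD ->].
have [m] := ubnP (wt P); elim: m P PD => // m IH P PD Pm.
have [wP|wP] := boolP (w P \in below (wt P)); last first.
  by rewrite mem_gen // imset_f // inE PD.
apply: (subsetP _ _ wP); rewrite gen_subG; apply/subsetP=> _ /imsetP[P' + ->].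
by rewrite inE => /andP[P'D P'P]; apply: IH => //; apply: leq_trans P'P _.
Qed.

(** Each weight level holds at most one greedy index, and passing such a level
    enlarges the generated group strictly, hence by a factor at least [p]. *)
Lemma card_below t : p ^ #|[set P in greedy | wt P < t]| <= #|below t|.
Proof.
elim: t => [|t IH].
  rewrite (_ : [set P in greedy | _] = set0) ?cards0 ?cardG_gt0 //.
  by apply/setP=> P; rewrite !inE ltn0 andbF.
have sub : below t \subset below t.+1.
  apply/genS/imsetS/subsetP => P; rewrite !inE => /andP[-> h].
  exact: ltnW.
have [N0|[Q]] := set_0Vmem [set P in greedy | wt P == t].
  apply: leq_trans (subset_leq_card sub); apply: leq_trans IH.
  rewrite leq_exp2l ?prime_gt1 //; apply/subset_leq_card/subsetP => P.
  rewrite !inE ltnS leq_eqVlt => /andP[Pg /orP[Pt|->]]; last by rewrite Pg.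
  by have := in_set0 P; rewrite -N0 !inE Pg Pt.
rewrite !inE => /andP[/andP[QD wQ] /eqP Qt].
have : #|[set P in greedy | wt P < t.+1]| <= #|[set P in greedy | wt P < t]|.+1.
  rewrite -[leqRHS]add1n -(cards1 Q).
  apply: leq_trans (leq_card_setU [set Q] [set P in greedy | wt P < t]).1.
  apply/subset_leq_card/subsetP => P.
  rewrite !inE ltnS leq_eqVlt => /andP[/andP[PD wP]].
  case/orP=> [/eqP Pt|->]; last by rewrite PD wP orbT.
  by rewrite (wt_inj PD QD) ?eqxx // Pt.
move/(leq_pexp2l (prime_gt0 p_pr))/leq_trans; apply; rewrite expnSr.
rewrite -(Lagrange sub) leq_mul //.
have : (#|below t.+1 : below t| %| #|below t.+1|)%N by apply: dvdn_indexg.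
have [n ->] := p_natP (abelem_pgroup (below_abelem t.+1)).
case/(dvdn_pfactor _ _ p_pr)=> -[_ /eqP|j _ ->]; last first.
  by rewrite expnS leq_pmulr // expn_gt0 prime_gt0.
have wQt : w Q \in below t.+1 by rewrite mem_gen // imset_f // inE QD Qt /=.
by rewrite indexg_eq1 => /subsetP/(_ _ wQt); rewrite -{1}Qt (negPf wQ).
Qed.

(** The greedy indices generate, and they are independent by [card_below]. *)
Lemma card_greedy : #|W| = (p ^ #|greedy|)%N.
Proof.
apply/eqP; rewrite eqn_leq; apply/andP; split.
  have := card_abelem_gen p_pr; rewrite -{1}gen_greedy => /(_ _ (w @: greedy)).
  rewrite gen_greedy => /(_ abW)/leq_trans; apply.
  by rewrite leq_exp2l ?prime_gt1 // leq_imset_card.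
pose t := (\max_(P in D) wt P).+1.
have lt_t P : P \in D -> wt P < t by move=> PD; rewrite ltnS leq_bigmax_cond.
have := card_below t.
rewrite (_ : [set P in greedy | _] = greedy); last first.
  apply/setP=> P; rewrite !inE; case: (boolP (P \in D)) => //= /lt_t ->.
  by rewrite andbT.
move/leq_trans; apply; apply/subset_leq_card; rewrite -genW; apply/genS/imsetS.
by apply/subsetP=> P; rewrite inE => /andP[].
Qed.
End Greedy.

(** * The derived subgroup of a central extension of a special group *)

Section CentralExtension.
Local Open Scope group_scope.
Variables (gT : finGroupType) (E A : {group gT}) (p k d : nat).
Variable x : 'I_d -> gT.
Hypotheses (p_pr : prime p) (AZ : A \subset 'Z(E)).
Hypothesis genE : <<A :|: x @: setT>> = E.
Hypothesis EA_special : special_of_rank p k (E / A).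

Let sAE : A \subset E. Proof. exact: subset_trans AZ (subsetIl _ _). Qed.
Let normZ (R : {group gT}) : R \subset 'Z(E) -> E \subset 'N(R).
Proof.
by move=> cR; rewrite (subset_trans _ (cent_sub _)) // centsC (subset_trans cR) ?subsetIr.
Qed.
Let nAE := normZ AZ.
Let xE i : x i \in E.
Proof. by rewrite -genE mem_gen // inE imset_f ?orbT. Qed.

Local Notation E' := E^`(1).
Local Notation Q := [~: E', E].

Let sE'E : E' \subset E := der_sub 1 E.

Let der1_quo : (E / A)^`(1) = E' / A.
Proof. by rewrite quotient_der. Qed.

Let sQA : Q \subset A.
Proof.
have [_ [_ eD] _ _] := EA_special.
rewrite -quotient_cents2 ?(subset_trans sE'E) // -der1_quo eD.
exact: subsetIr.
Qed.

Let abE'A : p.-abelem (E' / A).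
Proof. by have [_ [_ eD] h _] := EA_special; rewrite -der1_quo eD. Qed.

(* Elementary abelian sections of E / A, read in E. *)
Let der_exp u : u \in E' -> u ^+ p \in A.
Proof.
move=> uE'; have uE := subsetP sE'E u uE'; have uN := subsetP nAE u uE.
apply: coset_idr; first by rewrite groupX.
by have /abelemP[//|_ h] := abE'A; rewrite morphX ?h ?mem_quotient.
Qed.

Let exp_mod u : u \in E -> u ^+ p \in E' * A.
Proof.
move=> uE; have [pG [ePhi eD] _ _] := EA_special; have uN := subsetP nAE u uE.
have nPhi := Phi_normal (E / A).
have cuE : coset A u \in E / A by rewrite mem_quotient.
have cuX : coset A (u ^+ p) \in E' / A.
  rewrite -der1_quo eD -ePhi morphX //.
  have /abelemP[//|_ h] := Phi_quotient_abelem pG.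
  apply: coset_idr; first by rewrite groupX // (subsetP (normal_norm nPhi)).
  by rewrite morphX ?(subsetP (normal_norm nPhi)) // h ?mem_quotient.
rewrite normC ?(subset_trans sE'E) //.
by rewrite -quotientK ?(subset_trans sE'E) // mem_morphpre // groupX.
Qed.

(** The commutator attached to an unordered pair, up to inversion: the pick decides
    the order of the two generators, which membership in a subgroup does not
    see. *)
Definition comm_of (P : {set 'I_d}) : gT :=
  if [pick ij : 'I_d * 'I_d | P == [set ij.1; ij.2]] is Some ij
  then [~ x ij.1, x ij.2] else 1.

Lemma comm_ofP (H : {group gT}) i j :
  (comm_of [set i; j] \in H) = ([~ x i, x j] \in H).
Proof.
rewrite /comm_of; case: pickP => [[a b] /= /eqP e|/(_ (i, j))]; last by rewrite eqxx.
have : (a \in [set i; j]) && (b \in [set i; j]) by rewrite e !inE !eqxx orbT.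
have : (i \in [set a; b]) && (j \in [set a; b]) by rewrite -e !inE !eqxx orbT.
rewrite !inE => /andP[/orP[]/eqP-> /orP[]/eqP->] //.
- by move=> /andP[_ /orP[]/eqP->].
- by rewrite -groupV invg_comm.
- by move=> /andP[/orP[]/eqP-> _].
Qed.

Local Notation pairs := [set P : {set 'I_d} | #|P| == 2].

(** Binary weights are additive, so the three splittings of a triple into a pair
    and an apex have the same total weight, and they separate pairs. *)
Definition weight (P : {set 'I_d}) := \sum_(i in P) 2 ^ i.

Lemma weight_pair i j : i != j -> weight [set i; j] = (2 ^ i + 2 ^ j)%N.
Proof. by move=> ij; rewrite /weight big_setU1 ?inE // big_set1. Qed.

Lemma weight_inj : {in pairs &, injective weight}.
Proof.
have norm P : P \in pairs -> exists i j : 'I_d, i < j /\ P = [set i; j].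
  rewrite inE => /cards2P[i [j [ij ->]]].
  case: (ltngtP i j) => [h|h|/val_inj h]; [by exists i, j| |by rewrite h eqxx in ij].
  by exists j, i; rewrite setUC.
have lt (i j i' j' : nat) : i < j -> j < j' -> (2 ^ i + 2 ^ j < 2 ^ i' + 2 ^ j')%N.
  move=> ij jj'; have := leq_pexp2l (isT : 0 < 2) jj'.
  have : 2 ^ i < 2 ^ j by rewrite ltn_exp2l.
  rewrite [(2 ^ j.+1)%N]expnS; lia.
move=> P P' /norm[i [j [ij ->]]] /norm[i' [j' [ij' ->]]].
have neq (a b : 'I_d) : a < b -> a != b by move=> ab; rewrite -val_eqE neq_ltn ab.
rewrite !weight_pair ?neq //.
move=> e; have jj' : j = j' :> nat.
  case: (ltngtP j j') => // h; first by have := lt _ _ i' _ ij h; rewrite e ltnn.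
  by have := lt _ _ i _ ij' h; rewrite e ltnn.
rewrite jj' in e; have /eqP := addIn e; rewrite eqn_exp2l // => /eqP ii'.
by rewrite (val_inj ii') (val_inj jj').
Qed.

Let wbar P := coset A (comm_of P).
Local Notation basis := (greedy pairs wbar weight).

(** For a triple containing a basis pair, the apex [l] of the generator
    [[~ comm_of (T :\ l), x l]] that the Jacobi identity for [T] eliminates. *)
Definition pick_apex (T : {set 'I_d}) := [pick l in T | T :\ l \in basis].

(** Indices of the generators of [[E', E]] that survive: basis pairs with an apex,
    minus the generator eliminated by each triple. *)
Definition retained := [set Pl : {set 'I_d} * 'I_d | (Pl.1 \in basis) &&
  ~~ ((Pl.2 \notin Pl.1) && (pick_apex (Pl.2 |: Pl.1) == Some Pl.2))].

Definition lie_gens := [set [~ comm_of Pl.1, x Pl.2] | Pl in retained].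

Lemma comm_of_der P : comm_of P \in E'.
Proof. by rewrite /comm_of; case: pickP => [ij _|_]; rewrite ?group1 // mem_commg. Qed.

Let lie_gensA : lie_gens \subset A.
Proof.
apply/subsetP=> _ /imsetP[Pl _ ->]; apply: (subsetP sQA).
by rewrite mem_commg // comm_of_der.
Qed.
Let R := <<lie_gens>>%G.
Let sRA : R \subset A. Proof. by rewrite gen_subG. Qed.
Let nRE : E \subset 'N(R). Proof. exact/normZ/(subset_trans sRA). Qed.

Lemma lie_gen_pair i j l :
  ([~ comm_of [set i; j], x l] \in R) = ([~ x i, x j, x l] \in R).
Proof.
have := comm_ofP (Group (cent_mod_group_set (x l) nRE)) i j.
by rewrite !inE !(subsetP sE'E) ?comm_of_der ?mem_commg.
Qed.

Lemma pair_in i j : i != j -> [set i; j] \in pairs.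
Proof. by move=> ij; rewrite inE cards2 ij. Qed.

(** Induction on the total weight.  A pair outside the basis has its commutator
    generated, modulo [A], by those of smaller pairs.  An eliminated generator is
    obtained by the Jacobi identity from the two others of its triple; these have
    the same total weight but are retained or have a pair outside the basis,
    which the first case covers. *)
Lemma lie_gen_mem P l : P \in pairs -> [~ comm_of P, x l] \in R.
Proof.
have [m] := ubnP (weight P + 2 ^ l); elim: m P l => // m IH P l Pm PD.
have dependent P1 (l1 : 'I_d) : P1 \in pairs -> P1 \notin basis ->
    weight P1 + 2 ^ l1 = (weight P + 2 ^ l)%N -> [~ comm_of P1, x l1] \in R.
  move=> P1D; rewrite inE P1D /= negbK => P1b eqw.
  have gC := cent_mod_group_set (x l1) nRE; pose C := Group gC.
  have nAC : A <| C.
    rewrite /normal; apply/andP; split.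
      apply/subsetP=> a aA; rewrite inE (subsetP sAE) //=.
      have /centerP[_ /(_ _ (xE l1))/commgP/eqP->] := subsetP AZ a aA.
      by rewrite group1.
    by apply: subset_trans nAE; apply/subsetP=> h; rewrite inE => /andP[].
  suff : comm_of P1 \in C by rewrite inE => /andP[].
  rewrite -(quotientGK nAC) mem_morphpre ?(subsetP nAE) ?(subsetP sE'E) ?comm_of_der //.
  apply: (subsetP _ _ P1b); rewrite gen_subG; apply/subsetP=> _ /imsetP[P2 + ->].
  rewrite inE => /andP[P2D lt2]; rewrite mem_quotient // inE.
  rewrite (subsetP sE'E) ?comm_of_der //= IH //.
  by rewrite ltnS in Pm; apply: leq_trans Pm; rewrite -eqw ltn_add2r.
have [PB|PB] := boolP (P \in basis); last exact: dependent.
have [ret|] := boolP ((P, l) \in retained).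
  by rewrite mem_gen //; apply/imsetP; exists (P, l).
rewrite inE PB /= negbK => /andP[lP /eqP selP].
have other P1 (l1 : 'I_d) : P1 \in pairs -> l1 \notin P1 ->
    l1 |: P1 = l |: P -> l1 != l ->
    weight P1 + 2 ^ l1 = (weight P + 2 ^ l)%N -> [~ comm_of P1, x l1] \in R.
  move=> P1D l1P1 eT l1l eqw.
  have [P1B|/dependent] := boolP (P1 \in basis); last exact.
  rewrite mem_gen //; apply/imsetP; exists (P1, l1) => //.
  rewrite inE P1B /= l1P1 eT selP; apply: contra l1l => /eqP[->].
  by rewrite eqxx.
move: (PD); rewrite inE => /cards2P[i [j [ij eP]]].
move: lP; rewrite eP !inE negb_or => /andP[li lj].
rewrite lie_gen_pair; apply: (@Hall_Witt_mod _ E) => //.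
- by rewrite -derg1 (subset_trans sQA).
- exact: subset_trans sRA AZ.
- rewrite -lie_gen_pair other ?pair_in // 1?eq_sym //.
  + by rewrite !inE negb_or ij eq_sym li.
  + by rewrite eP setUA setUC.
  + by rewrite eP !weight_pair // 1?eq_sym // addnC addnA.
- rewrite -lie_gen_pair other ?pair_in // 1?eq_sym //.
  + by rewrite !inE negb_or ![j == _]eq_sym lj ij.
  + by rewrite eP setUC -setUA.
  + by rewrite eP !weight_pair // 1?eq_sym // -addnA addnC.
Qed.

(** Modulo the central subgroup [R], each [[x_i, x_j]] commutes with all generators
    of [E], so [E / R] has central derived subgroup. *)
Lemma lie_gens_lower_central : Q \subset R.
Proof.
have cen a b : [~ a, b] \in R -> [~ b, a] \in R by rewrite -invg_comm groupV.
have cA a e : a \in A -> e \in E -> [~ a, e] \in R.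
  move=> aA eE; have /centerP[_ /(_ _ eE)/commgP/eqP->] := subsetP AZ a aA.
  exact: group1.
have cP P e : P \in pairs -> e \in E -> [~ comm_of P, e] \in R.
  move=> PD; pose C := Group (cent_mod_group_set (comm_of P) nRE).
  suff /subsetP sEC : E \subset C by move/sEC; rewrite inE => /andP[_ /cen].
  rewrite -{1}genE gen_subG subUset; apply/andP; split; apply/subsetP => u.
    by move=> uA; rewrite inE (subsetP sAE) //= cA // (subsetP sE'E) ?comm_of_der.
  by case/imsetP=> l _ ->; rewrite inE xE cen ?lie_gen_mem.
have cx i j e : e \in E -> [~ x i, x j, e] \in R.
  move=> eE; have [->|ij] := eqVneq i j; first by rewrite commgg comm1g.
  have := comm_ofP (Group (cent_mod_group_set e nRE)) i j.
  rewrite !inE !(subsetP sE'E) ?comm_of_der ?mem_commg //= => <-.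
  by rewrite cP ?pair_in.
rewrite -quotient_cents2 ?(subset_trans sE'E) // quotient_der //.
suff : (E / R)^`(1) \subset 'Z(E / R) by move/subset_trans; apply; apply: subsetIr.
have nSR : A :|: x @: setT \subset 'N(R).
  by apply: subset_trans nRE; rewrite -genE subset_gen.
apply: (@der1_sub_gen _ ((A :|: x @: setT) / R)).
- by rewrite -quotient_gen ?genE.
- by rewrite gFnorm.
move=> _ _ /morphimP[a aN aS ->] /morphimP[b bN bS ->].
have aE : a \in E by rewrite -genE mem_gen.
have bE : b \in E by rewrite -genE mem_gen.
have sN := subsetP nRE.
rewrite -morphR //; apply/centerP; split; first by rewrite mem_quotient ?groupR.
move=> _ /morphimP[c cN cE ->]; apply/commgP.
rewrite -morphR ?groupR //; apply/eqP/coset_id.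
move: aS bS; rewrite !inE.
case/orP=> [aA _|/imsetP[i _ ->]].
  have /centerP[_ /(_ _ bE)/commgP/eqP->] := subsetP AZ a aA.
  by rewrite comm1g.
case/orP=> [bA|/imsetP[j _ ->]]; last exact: cx.
have /centerP[_ /(_ _ (xE i))/esym/commgP/eqP->] := subsetP AZ b bA.
by rewrite comm1g.
Qed.

Lemma card_lower_central : #|Q| <= p ^ #|retained|.
Proof.
have abR : p.-abelem <<lie_gens>>.
  apply: abelem_gen => //.
    rewrite (abelianS sRA) //; apply: abelianS AZ _; exact: center_abelian.
  move=> _ /imsetP[[P l] /= _ ->].
  have cQ : [~ comm_of P, x l] \in A by rewrite (subsetP sQA) // mem_commg ?comm_of_der.
  have com g : g \in E -> commute [~ comm_of P, x l] g.
    by move=> gE; have /centerP[_ /(_ _ gE)] := subsetP AZ _ cQ.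
  rewrite -commXg; last by apply/esym/com/(subsetP sE'E); exact: comm_of_der.
  have /centerP[_ /(_ _ (xE l))/commgP/eqP->//] :=
    subsetP AZ _ (der_exp (comm_of_der P)).
apply: leq_trans (subset_leq_card lie_gens_lower_central) _.
apply: leq_trans (card_abelem_gen p_pr abR) _.
by rewrite leq_exp2l ?prime_gt1 // leq_imset_card.
Qed.

Lemma der1_sub_pairs : E' \subset <<comm_of @: pairs>> <*> Q.
Proof.
have sSE' : <<comm_of @: pairs>> <*> Q \subset E'.
  rewrite join_subG commg_subl gFnorm andbT gen_subG.
  by apply/subsetP=> _ /imsetP[P _ ->]; apply: comm_of_der.
apply: der1_sub_gen genE _ _.
  rewrite -commg_subl; apply: subset_trans (joing_subr _ _).
  exact: commSg.
move=> a b aS bS.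
have aE : a \in E by rewrite -genE mem_gen.
have bE : b \in E by rewrite -genE mem_gen.
move: aS bS; rewrite !inE.
case/orP=> [aA _|/imsetP[i _ ->]].
  by have /centerP[_ /(_ _ bE)/commgP/eqP->] := subsetP AZ a aA.
case/orP=> [bA|/imsetP[j _ ->]].
  by have /centerP[_ /(_ _ (xE i))/esym/commgP/eqP->] := subsetP AZ b bA.
have [->|ij] := eqVneq i j; first by rewrite commgg.
rewrite -comm_ofP (subsetP (joing_subl _ _)) // mem_gen // imset_f //.
exact: pair_in.
Qed.

Lemma gen_wbar : <<wbar @: pairs>> = E' / A.
Proof.
have sub : comm_of @: pairs \subset E'.
  by apply/subsetP=> _ /imsetP[P _ ->]; apply: comm_of_der.
have nS : comm_of @: pairs \subset 'N(A).
  exact/(subset_trans sub)/(subset_trans sE'E).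
have -> : wbar @: pairs = (comm_of @: pairs) / A.
  rewrite /quotient morphimEsub // -imset_comp.
  exact: eq_imset.
rewrite -quotient_gen //; apply/eqP; rewrite eqEsubset quotientS ?gen_subG //=.
apply: subset_trans (quotientS _ der1_sub_pairs) _.
have nQ : Q \subset 'N(A) := subset_trans sQA (normG A).
have nSg : <<comm_of @: pairs>> \subset 'N(A) by rewrite gen_subG.
rewrite quotientY // join_subG subxx /=.
by rewrite (_ : Q / A = 1) ?sub1G //; apply/trivgP; rewrite quotient_sub1.
Qed.

Lemma card_basis : #|basis| = k.
Proof.
have [_ [_ eD] _ cZ] := EA_special.
have := card_greedy p_pr abE'A gen_wbar weight_inj.
have -> : #|E' / A| = (p ^ k)%N by rewrite -der1_quo eD.
by move/eqP; rewrite eqn_exp2l ?prime_gt1 // => /eqP.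
Qed.

(** In [E / [E', E]] commutators are bimultiplicative, so
    [[x_i, x_j] ^ p = [x_i ^ p, x_j]], which is trivial because [x_i ^ p] lies in
    [E' A]: the quotient is elementary abelian. *)
Lemma card_der1_quo : #|E' / Q| <= p ^ 'C(d, 2).
Proof.
have nQE : E \subset 'N(Q) by apply: normZ; apply: subset_trans AZ.
have sub : comm_of @: pairs \subset E'.
  by apply/subsetP=> _ /imsetP[P _ ->]; apply: comm_of_der.
have nS : comm_of @: pairs \subset 'N(Q).
  exact/(subset_trans sub)/(subset_trans sE'E).
have genQ : <<(comm_of @: pairs) / Q>> = E' / Q.
  rewrite -quotient_gen //; apply/eqP; rewrite eqEsubset quotientS ?gen_subG //=.
  apply: subset_trans (quotientS _ der1_sub_pairs) _.
  have nSg : <<comm_of @: pairs>> \subset 'N(Q) by rewrite gen_subG.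
  by rewrite quotientY ?normG // join_subG subxx trivg_quotient sub1G.
have cE'Q : E' / Q \subset 'C(E / Q).
  by rewrite quotient_cents2 // (subset_trans sE'E).
have ab : p.-abelem <<(comm_of @: pairs) / Q>>.
  apply: abelem_gen => //.
    by rewrite genQ /abelian (subset_trans cE'Q) // centS // quotientS.
  move=> _ /morphimP[_ _ /imsetP[P _ ->] ->]; rewrite /comm_of.
  case: pickP => [[i j] _ /=|_]; last by rewrite morph1 expg1n.
  have sN := subsetP nQE.
  rewrite morphR ?sN // -commXg; last first.
    apply/commute_sym/(centP (subsetP cE'Q _ _)); last by rewrite mem_quotient.
    by rewrite -morphR ?sN // mem_quotient // mem_commg.
  rewrite -morphX ?sN // -morphR ?sN ?groupX //; apply: coset_id.
  have /mulsgP[u a uE' aA ->] := exp_mod (xE i).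
  rewrite commMgJ.
  have /centerP[_ /(_ _ (xE j))/commgP/eqP->] := subsetP AZ a aA.
  by rewrite mulg1 memJ_norm ?mem_commg // sN // (subsetP sAE).
rewrite -genQ; apply: leq_trans (card_abelem_gen p_pr ab) _.
rewrite leq_exp2l ?prime_gt1 //.
apply: leq_trans (leq_imset_card _ _) _.
apply: leq_trans (subset_leq_card (subsetIr _ _)) _.
apply: leq_trans (leq_imset_card _ _) _.
by rewrite card_draws card_ord.
Qed.

Let basis2 : basis \subset pairs.
Proof. by apply/subsetP=> P /setIdP[]. Qed.

(** The triples for which the Jacobi identity eliminates a generator. *)
Definition saving_triples :=
  [set T : {set 'I_d} | (#|T| == 3) && [exists v in T, T :\ v \in basis]].

(** The eliminated generators map onto the saving triples by
    [(P, l) |-> l |: P]. *)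
Lemma card_retained : #|retained| + #|saving_triples| <= d * k.
Proof.
pose all_gens := setX basis [set: 'I_d].
have sub : retained \subset all_gens.
  by apply/subsetP=> -[P l]; rewrite !inE => /andP[/= -> _].
have -> : (d * k = #|all_gens|)%N by rewrite cardsX card_basis cardsT card_ord mulnC.
rewrite -(cardsID retained all_gens) (setIidPr sub) leq_add2l.
apply: leq_trans (leq_imset_card (fun Pl => Pl.2 |: Pl.1) _).
apply/subset_leq_card/subsetP=> T.
rewrite [T \in saving_triples]inE => /andP[_ /exists_inP[v vT vB]].
have [l0 el0] : exists l, pick_apex T = Some l.
  by rewrite /pick_apex; case: pickP => [l0 _|/(_ v)]; [exists l0 | rewrite vT vB].
have [l0T l0B] : l0 \in T /\ T :\ l0 \in basis.
  by move: el0; rewrite /pick_apex; case: pickP => // a /andP[aT aB] [<-].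
apply/imsetP; exists (T :\ l0, l0); last by rewrite /= setD1K.
by rewrite in_setD in_setX in_setT /= andbT l0B inE /= setD1K // el0 l0B setD11 eqxx.
Qed.

Lemma card_saving_triples :
  #|saving_triples| + #|triangles (pairs :\: basis)| = 'C(d, 3).
Proof.
rewrite -[in RHS](card_ord d) -card_draws.
rewrite -[RHS](cardsID [set T : {set 'I_d} | [exists v in T, T :\ v \in basis]]).
congr (_ + _); apply: eq_card => T; rewrite !inE //.
rewrite andbC; case: (boolP (#|T| == 3)) => T3; rewrite ?andbF ?andbT //=.
rewrite negb_exists; apply: eq_forallb => v; rewrite negb_and implybE.
case: (boolP (v \in T)) => //= vT; rewrite inE [T :\ v \in pairs]inE.
by move: T3; rewrite (cardsD1 v) vT add1n eqSS => ->; rewrite andbT.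
Qed.

(** As [#|E'| = #|E' :&: A| * p ^ k], it remains to multiply the bounds for
    [[E', E]] and for [E' / [E', E]]. *)
Theorem card_der1_center_bound r s : k <= 'C(d, 2) -> s < r ->
    'C(d, 2) - k = ('C(r, 2) + s)%N ->
  #|E' :&: A| * p ^ (k + 'C(d, 3)) <= p ^ ('C(d, 2) + d * k + ('C(r, 3) + 'C(s, 2))).
Proof.
move=> kd sr ek.
have tri : #|triangles (pairs :\: basis)| <= 'C(r, 3) + 'C(s, 2).
  apply: triangles_le sr _; first by move=> P; rewrite !inE => /andP[_ /eqP].
  by rewrite cardsD (setIidPr basis2) card_basis card_draws card_ord.
have [_ [_ eD] _ cZ] := EA_special.
have cE' : #|E'| = (#|E' :&: A| * p ^ k)%N.
  rewrite -cZ -eD der1_quo card_quotient ?(subset_trans sE'E) //.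
  by rewrite LagrangeI.
have cE'2 : #|E'| = (#|Q| * #|E' / Q|)%N.
  have sQE' : Q \subset E' by rewrite commg_subl gFnorm.
  rewrite card_quotient ?Lagrange //.
  by apply: subset_trans sE'E _; apply/normZ/(subset_trans sQA).
rewrite expnD mulnA -cE' cE'2.
have := leq_mul card_lower_central card_der1_quo.
rewrite -expnD => h; apply: leq_trans (leq_mul h (leqnn _)) _.
rewrite -expnD leq_exp2l ?prime_gt1 //.
move: card_retained card_saving_triples tri.
move: #|retained| #|saving_triples| #|triangles _| => a b c; clear; lia.
Qed.
End CentralExtension.

(** * Group extensions from cocycles *)

(** An abelian finite group in additive notation; the carrier is tagged by the
    commutativity proof so that the zmodType structure can be inferred. *)
Definition additive_of (gT : finGroupType)
  (comm : forall a b : gT, (a * b = b * a)%g) : Type := gT.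

Section AdditiveOf.
Local Open Scope ring_scope.
Variables (gT : finGroupType) (comm : forall a b : gT, (a * b = b * a)%g).
Local Notation V := (additive_of comm).
HB.instance Definition _ := Finite.on V.
Let addA : associative (fun a b : V => (a * b)%g). Proof. exact: mulgA. Qed.
Let addC : commutative (fun a b : V => (a * b)%g). Proof. exact: comm. Qed.
Let add0 : left_id (1%g : V) (fun a b : V => (a * b)%g). Proof. exact: mul1g. Qed.
Let addN : left_inverse (1%g : V) (fun a : V => (a^-1)%g) (fun a b : V => (a * b)%g).
Proof. exact: mulVg. Qed.
HB.instance Definition _ := GRing.isZmodule.Build V addA addC add0 addN.
End AdditiveOf.

Section FreeAbelian.
Local Open Scope ring_scope.

Lemma free_ext_gen (I : finType) (V : zmodType) (f : I -> V) i :
  free_ext f (gen_of i) = f i.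
Proof.
rewrite /free_ext (bigD1 i) //= big1 ?addr0 ?ffunE ?eqxx ?mulr1z // => j ji.
by rewrite ffunE (negPf ji) mulr0z.
Qed.

Lemma free_ext_uniq (I : finType) (V : zmodType) (f : {ffun I -> int} -> V) c :
  {morph f : a b / a - b} -> f c = free_ext (fun i => f (gen_of i)) c.
Proof.
move=> fB; have f0 : f 0 = 0 by have := fB 0 0; rewrite !subrr.
have fN a : f (- a) = - f a by rewrite -[- a]sub0r fB f0 sub0r.
have fD a b : f (a + b) = f a + f b by rewrite -{1}(opprK b) fB fN opprK.
have fn a n : f (a *+ n) = f a *+ n by elim: n => // n IH; rewrite !mulrS fD IH.
have fz a (m : int) : f (a *~ m) = f a *~ m.
  by case: m => n; rewrite ?NegzE ?mulrNz ?fN -!pmulrn fn.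
have sumE : c = \sum_i gen_of i *~ c i.
  apply/ffunP=> j; rewrite sum_ffunE (bigD1 j) //= big1 ?addr0; last first.
    by move=> i ij; rewrite ffunMzE ffunE eq_sym (negPf ij) mul0rz.
  by rewrite ffunMzE ffunE eqxx intz.
rewrite {1}sumE /free_ext (big_morph f fD f0); apply: eq_bigr => i _.
exact: fz.
Qed.

End FreeAbelian.

Section Extension.
Local Open Scope ring_scope.
Variables (T : finGroupType) (V : finZmodType) (f : T -> T -> V).
Hypothesis cocycle : forall g h k, f h k + f g (h * k)%g = f (g * h)%g k + f g h.

(** The cocycle identity is an argument of the type so that the group structure
    can be inferred from it.  As [f 1 1] may be nonzero, it enters the neutral
    element and the embedding of [V]. *)
Definition extension
  of (forall g h k, f h k + f g (h * k)%g = f (g * h)%g k + f g h) : Type :=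
  (V * T)%type.

Local Notation E := (extension cocycle).
HB.instance Definition _ := Finite.on E.

Definition ext_mul (u v : E) : E := (u.1 + v.1 + f u.2 v.2, (u.2 * v.2)%g).
Definition ext_one : E := (- f 1%g 1%g, 1%g).
Definition ext_inv (u : E) : E :=
  (- u.1 - f (u.2^-1)%g u.2 - f 1%g 1%g, (u.2^-1)%g).

Lemma cocycle1g g : f 1%g g = f 1%g 1%g.
Proof. by have := cocycle 1%g 1%g g; rewrite !mul1g => /addrI. Qed.

Lemma cocycleg1 g : f g 1%g = f 1%g 1%g.
Proof. by have := cocycle g 1%g 1%g; rewrite !mulg1 addrC => /addrI/esym. Qed.

Lemma ext_mulA : associative ext_mul.
Proof.
case=> [a g] [b h] [c k]; rewrite /ext_mul /= mulgA; congr (_, _).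
rewrite -!addrA; congr (_ + (_ + _)).
rewrite [RHS]addrCA; congr (_ + _); rewrite cocycle.
exact: addrC.
Qed.

Lemma ext_mul1 : left_id ext_one ext_mul.
Proof.
case=> a g; rewrite /ext_mul /= mul1g cocycle1g; congr (_, _).
by rewrite addrAC addNr add0r.
Qed.

Lemma ext_mulV : left_inverse ext_one ext_inv ext_mul.
Proof.
case=> a g; rewrite /ext_mul /= mulVg; congr (_, _).
by rewrite -addrA -opprD [- (_ + _) - _]addrC subrK.
Qed.

HB.instance Definition _ := Finite_isGroup.Build E ext_mulA ext_mul1 ext_mulV.

Definition ext_proj (u : E) : T := u.2.
Lemma ext_projM : {in [set: E] &, {morph ext_proj : u v / (u * v)%g}}.
Proof. by []. Qed.
Canonical ext_proj_morphism := Morphism ext_projM.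

Definition ext_inj (a : V) : E := (a - f 1%g 1%g, 1%g).

Lemma ext_injD a b : ext_inj (a + b) = (ext_inj a * ext_inj b)%g.
Proof.
rewrite /ext_inj -[RHS]/(ext_mul _ _) /ext_mul /= mulg1; congr (_, _).
by rewrite -[RHS]addrA subrK addrAC.
Qed.

Lemma ext_inj_inj : injective ext_inj.
Proof. by move=> a b [] /addIr. Qed.

Lemma ext_kerP (u : E) : u \in ('ker ext_proj)%g -> exists a, u = ext_inj a.
Proof.
case: u => a g /kerP-/(_ (in_setT _)); rewrite /= => g1.
by exists (a + f 1%g 1%g); rewrite /ext_inj addrK -g1.
Qed.

Lemma ext_inj_ker a : ext_inj a \in ('ker ext_proj)%g.
Proof. by apply/kerP; rewrite ?in_setT. Qed.

Lemma ext_ker_center : ('ker ext_proj \subset 'Z([set: E]))%g.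
Proof.
apply/subsetP=> u /ext_kerP[a ->]; apply/centerP; split; first exact: in_setT.
case=> b g _; rewrite /commute -![(_ * _)%g]/(ext_mul _ _) /ext_mul /= mul1g mulg1.
by rewrite cocycle1g cocycleg1 [b + _]addrC.
Qed.

(** The cocycle measures the failure of [g |-> (0, g)] to be a morphism. *)
Lemma ext_mul_sect g h :
  (((0, g) : E) * ((0, h) : E))%g = (ext_inj (f g h) * ((0, (g * h)%g) : E))%g.
Proof.
rewrite -![(_ * _)%g]/(ext_mul _ _) /ext_mul /= mul1g; congr (_, _).
by rewrite cocycle1g !addr0 add0r subrK.
Qed.

Lemma ext_quotient_isog : ([set: E] / 'ker ext_proj \isog [set: T])%g.
Proof.
have := first_isog ext_proj_morphism; congr (_ \isog _).
apply/setP=> g; rewrite inE; apply/imsetP; exists (0, g) => //.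
by rewrite inE in_setT.
Qed.
End Extension.

(** * The bar complex and the class of a cycle *)

Section BarComplex.
Local Open Scope ring_scope.

HB.instance Definition _ (I : finType) (V : zmodType) (f : I -> V) :=
  GRing.isZmodMorphism.Build {ffun I -> int} V (free_ext f) (free_extB f).

Lemma eq_free_ext (I : finType) (V : zmodType) (f g : I -> V) :
  f =1 g -> free_ext f =1 free_ext g.
Proof. by move=> fg c; apply: eq_bigr => i _; rewrite fg. Qed.

Variable T : finGroupType.

HB.instance Definition _ :=
  GRing.isZmodMorphism.Build (chain2 T) (chain1 T) (@bar_d2 T) (free_extB _).
HB.instance Definition _ :=
  GRing.isZmodMorphism.Build (chain3 T) (chain2 T) (@bar_d3 T) (free_extB _).

Lemma bar_d2_gen g h :
  bar_d2 (gen_of (g, h) : chain2 T) = gen_of h - gen_of (g * h)%g + gen_of g.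
Proof. exact: free_ext_gen. Qed.

Lemma bar_d3_gen g h k :
  bar_d3 (gen_of (g, h, k) : chain3 T) =
  gen_of (h, k) - gen_of ((g * h)%g, k) + gen_of (g, (h * k)%g) - gen_of (g, h).
Proof. exact: free_ext_gen. Qed.

Lemma bar_d2_d3 (c : chain3 T) : bar_d2 (bar_d3 c) = 0.
Proof.
rewrite (@free_ext_uniq _ _ (fun c => bar_d2 (bar_d3 c))); last first.
  by move=> a b; rewrite !raddfB.
rewrite /free_ext big1 // => -[[g h] k] _.
rewrite bar_d3_gen !(raddfB, raddfD) /= !bar_d2_gen mulgA.
rewrite [X in X *~ _](_ : _ = 0) ?mul0rz //.
by apply/ffunP=> u; rewrite !ffunE; ring.
Qed.

(** The order of the group annihilates H_2: summing the boundaries of [k|g|h] over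
    all [k] gives [#|T| [g|h]] up to a term that factors through [bar_d2], since
    [k |-> k g] permutes the group. *)
Lemma card_mul_cycle (z : chain2 T) : bar_d2 z = 0 ->
  exists c, bar_d3 c = z *+ #|T|.
Proof.
move=> z0.
pose S (x : T) : chain2 T := \sum_k gen_of (k, x).
pose cone (P : T * T) : chain3 T := \sum_k gen_of (k, P.1, P.2).
pose H c := bar_d3 (free_ext cone c) - (c *+ #|T| - free_ext S (bar_d2 c)).
have H0 : H z = 0.
  rewrite (@free_ext_uniq _ _ H); last first.
    move=> a b; rewrite /H !raddfB /= mulrnBl.
    move: (bar_d3 (free_ext cone a)) (bar_d3 (free_ext cone b)) (a *+ #|T|) (b *+ #|T|).
    move: (free_ext S _) (free_ext S _) => a1 b1 a2 b2 a3 b3.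
    by apply/ffunP=> u; rewrite !ffunE; ring.
  rewrite /free_ext big1 // => -[g h] _; rewrite /H free_ext_gen bar_d2_gen.
  suff -> : bar_d3 (cone (g, h)) = gen_of (g, h) *+ #|T|
      - free_ext S (gen_of h - gen_of (g * h)%g + gen_of g).
    by rewrite subrr mul0rz.
  rewrite raddf_sum !(raddfB, raddfD) /= !free_ext_gen.
  under eq_bigr => k _ do rewrite bar_d3_gen /=.
  have shift : \sum_k gen_of ((k * g)%g, h) = S h.
    by rewrite /S [RHS](reindex_inj (mulIg g)).
  rewrite !big_split /= !sumrN sumr_const shift.
  rewrite -[\sum_i gen_of (i, (g * h)%g)]/(S (g * h)%g) -[\sum_i gen_of (i, g)]/(S g).
  rewrite (_ : gen_of (g, h) *+ #|predT| = gen_of (g, h) *+ #|T|) //.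
  move: (S _) (S _) (S _) (_ *+ _) => a b c e.
  by apply/ffunP=> u; rewrite !ffunE; ring.
exists (free_ext cone z).
by move: H0; rewrite /H z0 raddf0 subr0 => /subr0_eq.
Qed.
End BarComplex.

Section UniversalClass.
Local Open Scope ring_scope.
Variables (T : finGroupType) (V : finZmodType) (q : chain2 T -> V).
Hypotheses (qB : {morph q : a b / a - b}) (q_bound : forall c, q (bar_d3 c) = 0).

Definition class_cocycle g h := q (gen_of (g, h)).

(** The cocycle identity for [q [g|h]] is the vanishing of [q] on [bar_d3 [g|h|k]]. *)
Lemma class_cocycleP g h k :
  class_cocycle h k + class_cocycle g (h * k)%g =
  class_cocycle (g * h)%g k + class_cocycle g h.
Proof.
have := q_bound (gen_of (g, h, k)); rewrite /bar_d3 free_ext_gen.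
have qD a b : q (a + b) = q a + q b.
  by have := qB (a + b) b; rewrite addrK => ->; rewrite subrK.
rewrite !(qB, qD) => /subr0_eq e.
by rewrite /class_cocycle -e addrAC [RHS]addrC subrK.
Qed.

Local Notation E := (extension class_cocycleP).
Local Notation inj := (@ext_inj _ _ _ class_cocycleP).

(** The abelianisation of the extension receives a map [mu] from 1-chains, sending
    [[g]] to the class of [(0, g)].  On generators, hence on all 2-chains,
    [mu \o bar_d2] agrees with the class of [q], so the class of a cycle
    vanishes in the abelianisation. *)
Lemma cycle_in_der1 z : bar_d2 z = 0 -> inj (q z) \in ([set: E]^`(1))%g.
Proof.
move=> z0; set D := ([set: E]^`(1))%g.
have nD (u : E) : u \in ('N(D))%g by rewrite (subsetP (der_norm 1 _)) ?inE.
have commD (a b : coset_of D) : (a * b = b * a)%g.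
  case: (cosetP a) => u uN ->; case: (cosetP b) => v vN ->.
  apply/commgP; rewrite -morphR //; apply/eqP/coset_id.
  by rewrite /D mem_commg ?inE.
pose U := additive_of commD.
pose lam c : U := coset D (inj (q c)).
pose mu (g : T) : U := coset D ((0, g) : E).
have lamB : {morph lam : a b / a - b}.
  move=> a b; apply: (canRL (addrK _)).
  rewrite -[LHS]/(coset D (inj (q (a - b))) * coset D (inj (q b)))%g.
  by rewrite -morphM // -ext_injD qB subrK.
have mu2 g h : lam (gen_of (g, h)) = mu h - mu (g * h)%g + mu g.
  rewrite addrAC [_ + mu g]addrC; apply: (canRL (addrK _)).
  rewrite -[RHS]/(mu g * mu h)%g -[LHS]/(lam (gen_of (g, h)) * mu (g * h))%g.
  by rewrite -!morphM // ext_mul_sect.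
suff : lam z = 0.
  by move/(coset_idr (nD _)).
rewrite (free_ext_uniq _ lamB).
have fB : {morph (fun c => free_ext mu (@bar_d2 T c)) : a b / a - b}.
  by move=> a b; rewrite !raddfB.
have := free_ext_uniq z fB; rewrite z0.
have -> : free_ext mu 0 = 0 by rewrite /free_ext big1 // => i _; rewrite ffunE mulr0z.
move=> e; rewrite [RHS]e; apply: eq_free_ext => -[g h].
have muD a b : free_ext mu (a + b) = free_ext mu a + free_ext mu b.
  exact: raddfD.
by rewrite bar_d2_gen muD free_extB !free_ext_gen mu2.
Qed.
End UniversalClass.

(** * Cycles modulo boundaries inside a finite extension *)

Lemma isog_special_of_rank (aT rT : finGroupType)
    (G : {group aT}) (H : {group rT}) p k :
  (G \isog H)%g -> special_of_rank p k G -> special_of_rank p k H.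
Proof.
move=> iGH [pG sG aZ cZ]; have iZ := isog_center iGH.
split; [by rewrite -(isog_pgroup p iGH) | exact: isog_special iGH sG | |].
- by rewrite -(isog_abelem iZ).
- by rewrite -(card_isog iZ).
Qed.

Section QuotientGenerators.
Local Open Scope group_scope.
Lemma quotient_generators (gT : finGroupType) (E A : {group gT}) :
  A <| E -> exists x : 'I_('m(E / A)) -> gT, <<A :|: x @: setT>> = E.
Proof.
move=> nAE; have [B genB <-] := grank_witness (E / A).
pose x (i : 'I_#|B|) : gT := repr (enum_val i).
exists x; have sAE := normal_sub nAE.
have xB i : coset A (x i) = enum_val i by rewrite coset_reprK.
have xN i : x i \in 'N(A) by rewrite repr_coset_norm.
have xE i : x i \in E.
  have cE : coset A (x i) \in E / A by rewrite xB -genB mem_gen // enum_valP.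
  have [y yN yE] := morphimP cE.
  move=> /(kercoset_rcoset (xN i) yN)[a aA ->].
  by rewrite groupM // (subsetP sAE).
apply/eqP; rewrite eqEsubset gen_subG subUset sAE /=; apply/andP; split.
  by apply/subsetP=> _ /imsetP[i _ ->].
have sN : A :|: x @: setT \subset 'N(A).
  rewrite subUset normG /=; by apply/subsetP=> _ /imsetP[i _ ->].
rewrite -(quotientSGK _ (subset_trans (subsetUl A _) (subset_gen _))) ?normal_norm //.
rewrite quotient_gen // -genB genS //; apply/subsetP=> b bB.
rewrite -[b](enum_rankK_in bB bB) -xB; apply: mem_morphim => //.
by rewrite inE imset_f ?orbT.
Qed.
End QuotientGenerators.

Section Bound.
Local Open Scope ring_scope.
Variables (T : finGroupType) (V : finZmodType) (q : chain2 T -> V).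
Hypotheses (qB : {morph q : a b / a - b}) (q_bound : forall c, q (bar_d3 c) = 0).
Local Notation E := (extension (class_cocycleP qB q_bound)).
Local Notation inj := (@ext_inj _ _ _ (class_cocycleP qB q_bound)).

(** The cycles of [T] take values under [q] in the intersection of the derived
    subgroup of the extension with its central kernel. *)
Lemma card_cycle_image p k r s (d := 'm([set: T])%g) : prime p ->
  special_of_rank p k [set: T]%G -> (k <= 'C(d, 2))%N -> (s < r)%N ->
  ('C(d, 2) - k = 'C(r, 2) + s)%N ->
  exists S : {set V}, [/\ forall z, bar_d2 z = 0 -> q z \in S &
   (#|S| * p ^ (k + 'C(d, 3)) <= p ^ ('C(d, 2) + d * k + ('C(r, 3) + 'C(s, 2))))%N].
Proof.
move=> p_pr spT kd sr ek.
set A := ('ker (@ext_proj _ _ _ (class_cocycleP qB q_bound)))%G.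
have iso := ext_quotient_isog (class_cocycleP qB q_bound).
have spE : special_of_rank p k ([set: E] / A)%G.
  by apply: isog_special_of_rank spT; rewrite isog_sym.
have dE : 'm([set: E] / A)%g = d by apply: isog_grank.
have [x genx] := quotient_generators
  (ker_normal (ext_proj_morphism (class_cocycleP qB q_bound))).
rewrite dE in x genx.
have bound := card_der1_center_bound p_pr (ext_ker_center _) genx spE kd sr ek.
exists [set v | inj v \in ([set: E]^`(1) :&: A)%g]; split.
  move=> z z0; rewrite inE; apply/setIP; split; last exact: ext_inj_ker.
  exact: cycle_in_der1.
apply: leq_trans bound; rewrite leq_mul2r; apply/orP; right.
rewrite -(card_imset _ (@ext_inj_inj _ _ _ (class_cocycleP qB q_bound))).
by apply/subset_leq_card/subsetP=> _ /imsetP[v + ->]; rewrite inE.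
Qed.
End Bound.

Section ModChain.
Local Open Scope ring_scope.

(** An alias, to carry both the finite group and the zmodType structures. *)
Definition mod_chain (T : finType) (M : nat) : Type := {ffun T -> 'Z_M}.
HB.instance Definition _ T M := Finite.on (mod_chain T M).
HB.instance Definition _ T M := GRing.Zmodule.on (mod_chain T M).
HB.instance Definition _ T M := [finGroupMixin of mod_chain T M for +%R].

End ModChain.

Section FiniteCoefficients.
Local Open Scope ring_scope.
Variables (T : finGroupType) (M : nat).
Hypothesis M_gt1 : (1 < M)%N.
Local Notation C := (mod_chain (T * T)%type M).

Definition reduce (c : chain2 T) : C := [ffun P => (c P)%:~R].

Lemma reduceB : {morph reduce : a b / a - b}.
Proof. by move=> a b; apply/ffunP=> P; rewrite !ffunE intrB. Qed.

Definition mod_boundaries : {set C} := [set v | `[< exists c, reduce (bar_d3 c) = v >]].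

Lemma mod_boundaries_group_set : group_set mod_boundaries.
Proof.
have r0 : reduce 0 = 0 by have := reduceB 0 0; rewrite !subrr.
apply/group_setP; split.
  by rewrite inE; apply/asboolP; exists 0; rewrite raddf0.
move=> a b; rewrite !inE => /asboolP[c <-] /asboolP[c' <-]; apply/asboolP.
exists (c + c'); rewrite raddfD /= -{1}[bar_d3 c']opprK reduceB.
by rewrite -[- bar_d3 c']sub0r reduceB r0 sub0r opprK.
Qed.
Canonical mod_boundaries_group := Group mod_boundaries_group_set.

Let normal_all (u : C) : u \in ('N(mod_boundaries))%g.
Proof.
apply/normP/setP=> v; rewrite mem_conjg /conjg.
suff -> : ((u^-1)^-1 * (v * u^-1))%g = v by [].
rewrite -[LHS]/(- - u + (v - u)); by rewrite opprK addrC subrK.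
Qed.

Lemma coset_commutative (a b : coset_of mod_boundaries) : (a * b = b * a)%g.
Proof.
case: (cosetP a) => u uN ->; case: (cosetP b) => v vN ->.
by rewrite -!morphM // [(u * v)%g](addrC u v).
Qed.
Local Notation V := (additive_of coset_commutative).

(** The universal boundary-killing map, with coefficients reduced modulo [M]. *)
Definition chain_class (c : chain2 T) : V := coset mod_boundaries (reduce c).

Lemma chain_classB : {morph chain_class : a b / a - b}.
Proof.
move=> a b; apply: (canRL (addrK _)).
rewrite -[LHS]/(coset _ (reduce (a - b)) * coset _ (reduce b))%g -morphM //.
by rewrite -[(_ * _)%g]/(_ + _) reduceB subrK.
Qed.

Lemma chain_class_bound c : chain_class (bar_d3 c) = 0.
Proof. by apply: coset_id; rewrite inE; apply/asboolP; exists c. Qed.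

(** If the class of [z] vanishes, then [z] is a boundary plus [M] times a chain [y].
    Chains being torsion-free, [y] is a cycle, so [M y] is a boundary
    by [card_mul_cycle]. *)
Lemma chain_class_cycle z : (#|T| %| M)%N -> bar_d2 z = 0 -> chain_class z = 0 ->
  exists c, bar_d3 c = z.
Proof.
move=> TM z0 /(coset_idr (normal_all _)); rewrite inE => /asboolP[c rc].
have dvdM P : exists m : int, (z - bar_d3 c) P = m * M%:Z.
  have : reduce (z - bar_d3 c) P = 0 by rewrite reduceB rc subrr ffunE.
  rewrite ffunE; move: ((z - bar_d3 c) P) => m m0; apply/dvdzP.
  rewrite dvdzE /= /dvdn -val_Zp_nat //.
  suff -> : (`|m|%N%:R : 'Z_M) = 0 by [].
  case: m m0 => i; rewrite ?NegzE ?mulrNz => /eqP; rewrite ?oppr_eq0 => /eqP h.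
    exact: h.
  by rewrite abszN; exact: h.
pose y : chain2 T := [ffun P => ((z - bar_d3 c) P %/ M)%Z].
have ey : z - bar_d3 c = y *+ M.
  apply/ffunP=> P; have [m em] := dvdM P; rewrite ffunMnE [y P]ffunE em.
  rewrite mulzK; first by rewrite -mulr_natr natz.
  by move: M_gt1; lia.
have y0 : bar_d2 y = 0.
  have : bar_d2 y *+ M = 0 by rewrite -raddfMn /= -ey raddfB /= z0 bar_d2_d3 subr0.
  move=> h; apply/ffunP=> g; have := congr1 (fun c : chain1 T => c g) h.
  rewrite ffunMnE !ffunE => /eqP; rewrite mulrn_eq0 => /orP[/eqP M0|/eqP //].
  by move: M_gt1; rewrite M0.
have [c' ec'] := card_mul_cycle y0; have /dvdnP[t et] := TM.
exists (c + c' *+ t); rewrite raddfD raddfMn /= ec' -mulrnA [(_ * t)%N]mulnC -et -ey.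
by rewrite addrC subrK.
Qed.
End FiniteCoefficients.

(** * The order of the Schur multiplier *)

From mathcomp Require Import classical_sets cardinality.

Lemma card_inj_finset (X : Type) (V : finType) (S : {set V}) (f : X -> V) :
  injective f -> (forall x, f x \in S) ->
  exists2 m, ([set: X] #= `I_m)%card & (m <= #|S|)%N.
Proof.
move=> f_inj fS; pose h x := index (f x) (enum S).
have h_inj : {in [set: X]%classic &, injective h}.
  move=> x y _ _ /(congr1 (nth (f x) (enum S))).
  by rewrite !nth_index ?mem_enum //; apply: f_inj.
have le : ([set: X] #<= `I_#|S|)%card.
  rewrite -(card_le_eql (inj_card_eq h_inj)); apply: subset_card_le.
  by move=> _ [x _ <-] /=; rewrite cardE index_mem mem_enum.
have [m em] : exists m, ([set: X] #= `I_m)%card.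
  by apply/finite_setP; apply: card_le_finite le _; apply: finite_II.
by exists m => //; rewrite -card_le_II -(card_le_eql em).
Qed.

Section SchurMultiplier.
Local Open Scope ring_scope.

(** A class is determined by the universal class of a representative cycle, taken
    with coefficients modulo the order of the group. *)
Theorem card_schur_special (gT : finGroupType) (G : {group gT}) p k r s
    (d := 'm(G)%g) :
  prime p -> special_of_rank p k G -> (0 < k <= 'C(d, 2))%N -> (s < r)%N ->
  ('C(d, 2) - k = 'C(r, 2) + s)%N ->
  exists2 m, ([set: schur G] #= `I_m)%card &
    (m * p ^ (k + 'C(d, 3)) <=
     p ^ ('C(d, 2) + d * k + ('C(r, 3) + 'C(s, 2))))%N.
Proof.
move=> p_pr G_special /andP[k_gt0 k_le] sr ek; pose T := subg_of G.
have spT : special_of_rank p k [set: T]%G.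
  exact: isog_special_of_rank (isog_subg G) G_special.
have dT : 'm([set: T])%g = d by apply/esym/isog_grank/isog_subg.
have cT : #|T| = #|G| by rewrite (card_isog (isog_subg G)) cardsT.
have T_gt1 : (1 < #|T|)%N.
  have [_ _ _ cZ] := G_special; rewrite cT.
  apply: leq_trans (subset_leq_card (center_sub G)); rewrite cZ.
  by rewrite -(exp1n k) ltn_exp2r ?prime_gt1.
have := card_cycle_image (@chain_classB T #|T|) (@chain_class_bound T #|T|)
   p_pr spT.
rewrite dT => /(_ _ _ k_le sr ek) [S [S_cycles S_card]].
have val0 (z : Z2 T) : bar_d2 (val z) = 0 by apply/eqP; exact: (valP z).
pose cls (h : schur G) := chain_class #|T| (val (generic_quotient.repr h)).
have cls_inj : injective cls.
  move=> h h' e; rewrite -[h]generic_quotient.reprK -[h']generic_quotient.reprK.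
  apply/eqP; rewrite -Quotient.idealrBE.
  apply/asboolP; apply: (@chain_class_cycle _ #|T|) => //; first exact: val0.
  by rewrite -[Z2_val _]/(val _) raddfB /= chain_classB -/(cls h) e subrr.
have [m eqm le_m] := card_inj_finset cls_inj (fun h => S_cycles _ (val0 _)).
by exists m => //; apply: leq_trans S_card; rewrite leq_mul2r le_m orbT.
Qed.
End SchurMultiplier.

Theorem theorem3p2 (gT : finGroupType) (G : {group gT}) (p n k d r s : nat)
  (p_prime : prime p)
  (G_special : special_of_rank p k G)
  (G_order : #|G| = (p ^ n)%N)
  (d_def : d = 'm(G)%g)
  (k_ge2 : (2 <= k)%N)
  (k_le : (k <= 'C(d, 2))%N)
  (r_gt0 : (0 < r)%N)
  (r_bounds : ('C(r, 2) <= 'C(d, 2) - k < 'C(r.+1, 2))%N)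
  (s_def : s = ('C(d, 2) - k - 'C(r, 2))%N) :
  exists2 m : nat, ([set: schur G] #= `I_m)%card &
    ((m%:R : rat) <=
     p%:R ^ (Posz ((d * (d + 2 * k - 1)) %/ 2) - Posz k
             - Posz 'C(d, 3) + Posz 'C(r, 3) + Posz 'C(s, 2)))%R.
Proof.
have sr : (s < r)%N by case/andP: r_bounds; rewrite binS bin1; lia.
have ek : ('C(d, 2) - k = 'C(r, 2) + s)%N by case/andP: r_bounds; lia.
have k_gt0 : (0 < k)%N by apply: ltnW.
have [m eqm bound] : exists2 m, ([set: schur G] #= `I_m)%card &
    (m * p ^ (k + 'C(d, 3)) <=
     p ^ ('C(d, 2) + d * k + ('C(r, 3) + 'C(s, 2))))%N.
  by move: k_le ek; rewrite d_def => k_le ek; apply: card_schur_special; rewrite ?k_gt0.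
exists m => //.
have half : ((d * (d + 2 * k - 1)) %/ 2 = 'C(d, 2) + d * k)%N.
  have : (0 < 'C(d, 2))%N by apply: leq_trans k_le.
  have := mul_bin_diag d 1; rewrite bin1; move: ('C(d, 2)) => c.
  case: (d) => [|e] /= dd; first by lia.
  move=> _; rewrite (_ : (e.+1 * (e.+1 + 2 * k - 1) = (c + e.+1 * k) * 2)%N) ?mulnK //.
  by rewrite addSn subn1 /=; nia.
have p0 : (p%:R != 0 :> rat)%R by rewrite pnatr_eq0 -lt0n prime_gt0.
have pp : ((0 : rat) < p%:R ^+ (k + 'C(d, 3)))%R.
  by rewrite exprn_gt0 // ltr0n prime_gt0.
rewrite half -(ler_pM2r pp) exprnP -expfzDr //.
rewrite (_ : (_ + Posz (k + _) = Posz ('C(d, 2) + d * k + ('C(r, 3) + 'C(s, 2))))%R);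
  last by lia.
by rewrite -!exprnP -!natrX -natrM ler_nat.
Qed.
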